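(* For all integers $n\ge s\ge 0$, \[ \mathrm{ex}(n,s)\le 3n^2-15ns+20s^2. \] Moreover, for $s\in\left[\frac38 n,\frac25 n\right]$ equality holds.
   Context: $\mathrm{ex}(n,s)$ is the maximum number of edges in a triangle-free graph on $n$ vertices with independence number at most $s$. *)

(* Defs.v *)
From mathcomp Require Import all_boot all_order all_algebra.

Set Implicit Arguments.
Unset Strict Implicit.
Unset Printing Implicit Defensive.

(* A finite simple graph on the vertex set T is given by its set E of edges,
   each edge being a 2-element set of vertices; in particular there are no
   loops, since #|[set x; x]| = 1, and the number of edges is #|E|. *)
Definition simple_graph (T : finType) (E : {set {set T}}) : bool :=
  [forall e in E, #|e| == 2].

Definition adjacent (T : finType) (E : {set {set T}}) : rel T :=
  fun x y => [set x; y] \in E.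

Definition triangle_free (T : finType) (E : {set {set T}}) : bool :=
  ~~ [exists x, exists y, exists z,
        [&& adjacent E x y, adjacent E y z & adjacent E x z]].

Definition independent (T : finType) (E : {set {set T}}) (A : {set T}) : bool :=
  [forall x in A, forall y in A, ~~ adjacent E x y].

Definition independence_number (T : finType) (E : {set {set T}}) : nat :=
  \max_(A : {set T} | independent E A) #|A|.

(* ex(n, s). When no triangle-free graph on n vertices has independence
   number at most s, the maximum ranges over an empty family and is 0. *)
Definition ex_num (n s : nat) : nat :=
  \max_(E : {set {set 'I_n}} |
          [&& simple_graph E, triangle_free E & independence_number E <= s])
     #|E|.

(* Main.v *)
Require Import Defs.
From mathcomp Require Import all_boot all_order all_algebra.
From mathcomp Require Import zify lra.

(* Let G be triangle-free on n vertices with independence number s, and put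
   x = 2 n - 5 s, d = 8 s - 3 n and def v = s - deg v. The bound says that the
   deficiencies sum to at least x d; it is trivial unless x, d > 0.
   Consider cyclic families of five independent sets, each disjoint from the next.
   If some family has total size at least 5 s - d, take a largest one: a Hall type
   argument bounds the edges between the vertices lying in two of the sets and the
   others, and the edge bound follows.
   Otherwise fix an independent set A of size s. A path a b b' a' with ends in A and
   b, b' outside A yields the family A, N(a), N(b), N(b'), N(a'), so its vertices have
   total deficiency more than d. This is a covering problem whose linear relaxation
   has half-integral solutions; rounding at a threshold t and using once more that
   vertices of small deficiency have large degree, each rounded solution costs at
   least x, and averaging over t gives total deficiency at least x d.
   Equality is attained by a blow-up of the Wagner graph. *)

Set Implicit Arguments.
Unset Strict Implicit.
Unset Printing Implicit Defensive.

Import Order.TTheory GRing.Theory Num.Theory.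

(** * Arc counts and a Hall type core of an independent set *)

Section Graph.

Variables (T : finType) (E : {set {set T}}).
Local Notation adj := (adjacent E).
Local Notation indep := (independent E).
Implicit Types (x y z : T) (A B M S X Y Z : {set T}).

Definition nbr x := [set y | adj x y].
Definition nbrs S := [set y | [exists x in S, adj x y]].
Definition arcs X Y := \sum_(x in X) #|nbr x :&: Y|.

Lemma adjC x y : adj x y = adj y x.
Proof. by rewrite /adjacent setUC. Qed.

Lemma in_nbr x y : (y \in nbr x) = adj x y.
Proof. by rewrite inE. Qed.

Lemma nbrsP S y : reflect (exists2 x, x \in S & adj x y) (y \in nbrs S).
Proof. by rewrite inE; apply: exists_inP. Qed.

Lemma indepP A : reflect {in A &, forall x y, ~~ adj x y} (indep A).
Proof.
apply: (iffP forall_inP) => H x.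
  by move=> y xA yA; move/forall_inP: (H x xA); apply.
by move=> xA; apply/forall_inP => y yA; apply: H.
Qed.

Lemma indepS A B : A \subset B -> indep B -> indep A.
Proof.
by move=> /subsetP sAB /indepP iB; apply/indepP => x y xA yA; apply: iB; apply: sAB.
Qed.

Lemma indepU A B :
  indep A -> indep B -> {in A & B, forall x y, ~~ adj x y} -> indep (A :|: B).
Proof.
move=> /indepP iA /indepP iB AB; apply/indepP => x y /setUP[] xA /setUP[] yA.
- exact: iA.
- exact: AB.
- by rewrite adjC; apply: AB.
- exact: iB.
Qed.

Lemma arcsC X Y : arcs X Y = arcs Y X.
Proof.
have arcsE A B : arcs A B = \sum_(x in A) \sum_(y in B) adj x y.
  apply: eq_bigr => x _; rewrite -sum1_card big_mkcond [RHS]big_mkcond /=.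
  by apply: eq_bigr => y _; rewrite !inE; case: adj; case: (y \in B).
rewrite !arcsE exchange_big; apply: eq_bigr => x _; apply: eq_bigr => y _.
by rewrite adjC.
Qed.

Lemma arcsUr X Y Z : [disjoint Y & Z] -> arcs X (Y :|: Z) = arcs X Y + arcs X Z.
Proof.
move=> dYZ; rewrite /arcs -big_split; apply: eq_bigr => x _ /=.
rewrite setIUr cardsU -setIIr; move: dYZ; rewrite -setI_eq0 => /eqP ->.
by rewrite setI0 cards0 subn0.
Qed.

Lemma arcsUl X Y Z : [disjoint Y & Z] -> arcs (Y :|: Z) X = arcs Y X + arcs Z X.
Proof. by move=> dYZ; rewrite ![arcs _ X]arcsC arcsUr. Qed.

Lemma arcsDr X Y Z : arcs X Y = arcs X (Y :&: Z) + arcs X (Y :\: Z).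
Proof.
rewrite -arcsUr ?setID // -setI_eq0; apply/eqP/setP => x.
by rewrite !inE; case: (x \in Z); rewrite ?andbF.
Qed.

Lemma leq_arcs X Y : arcs X Y <= #|X| * #|Y|.
Proof.
rewrite -sum_nat_const; apply: leq_sum => x _; exact: subset_leq_card (subsetIr _ _).
Qed.

Lemma handshake : simple_graph E -> arcs setT setT = 2 * #|E|.
Proof.
move=> /forall_inP sE.
have degE x : #|nbr x :&: setT| = \sum_(f in E) (x \in f).
  have inj : {in nbr x &, injective (fun y => [set x; y])}.
    move=> y z; rewrite !in_nbr => xy xz /setP eq_yz.
    have nx u : adj x u -> u != x.
      move=> /sE; rewrite cards2; apply: contraTN => /eqP ->.
      by rewrite eqxx.
    have := eq_yz y; rewrite !inE eqxx orbT (negPf (nx y xy)) /=.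
    by move=> /esym/eqP.
  rewrite setIT -(card_in_imset inj) -sum1_card [RHS]big_mkcond [LHS]big_mkcond /=.
  apply: eq_bigr => f _; case: imsetP => [[y xy ->]|nf].
    by move: xy; rewrite in_nbr /adjacent => ->; rewrite !inE eqxx.
  case: ifP => // fE; case xf: (x \in f) => //; case: nf.
  have /cards2P[a [b [ab fab]]] := sE f fE.
  rewrite fab !inE in xf; case/orP: xf => /eqP xE.
    by exists b; rewrite ?xE ?in_nbr /adjacent -?fab.
  by exists a; rewrite ?xE ?in_nbr /adjacent 1?setUC -?fab.
rewrite /arcs (eq_bigr _ (fun x _ => degE x)) exchange_big /=.
rewrite mulnC -sum_nat_const; apply: eq_bigr => f fE; rewrite -(eqP (sE f fE)).
rewrite -sum1_card [RHS]big_mkcond /= big_mkcond; apply: eq_bigr => x _.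
by rewrite inE; case: (x \in f).
Qed.

(* [M] is a minimal subset of [A] satisfying the first conclusion; were [S] a
   minimal violator of the second one, [M] could lose any element of [S]. *)
Lemma hall_core A X :
    indep A -> [disjoint A & X] ->
    (forall Z, Z \subset A :|: X -> indep Z -> #|Z| <= #|A|) ->
  exists2 M : {set T}, M \subset A &
    (forall Z, Z \subset M :|: X -> indep Z -> #|Z| <= #|M|) /\
    (forall S, S \subset M -> #|S| <= #|nbrs S :&: X|).
Proof.
move=> iA dAX maxA.
pose good (M : {set T}) := [forall Z : {set T}, (Z \subset M :|: X) && indep Z ==> (#|Z| <= #|M|)].
have goodP (M : {set T}) :
    reflect (forall Z, Z \subset M :|: X -> indep Z -> #|Z| <= #|M|) (good M).
  apply: (iffP forallP) => [H Z ZM iZ | H Z]; first by have := H Z; rewrite ZM iZ.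
  by apply/implyP => /andP[]; apply: H.
have gA : good A by apply/goodP.
have [M /minsetP[/goodP gM minM] MA] := minset_exists gA.
exists M => //; split=> // S0 S0M; rewrite leqNgt; apply/negP => bad0.
pose bad (S : {set T}) := (#|nbrs S :&: X| < #|S|).
have [S /minsetP[badS minS] SS0] := @minset_exists _ bad S0 bad0.
have SM := subset_trans SS0 S0M.
have [s sS] : exists s, s \in S.
  by apply/set0Pn; apply: contraTneq badS => ->; rewrite /bad cards0 ltn0.
have sM := subsetP SM s sS.
suff gMs : good (M :\ s).
  by have := minM _ gMs (subsetDl _ _) => /setP/(_ s); rewrite !inE eqxx sM.
apply/goodP => Z ZMs iZ.
have sZ : s \notin Z.
  apply/negP => /(subsetP ZMs); rewrite !inE eqxx /=.
  by rewrite (disjointFr dAX) ?(subsetP MA).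
have ZM : Z \subset M :|: X.
  by apply: subset_trans ZMs _; apply: setSU; apply: subsetDl.
pose NS := nbrs S :&: X.
(* Exchange: the part of [Z] in [S] and [NS] is traded for [S]. As [s] is not in [Z], minimality of
   [S] gives the Hall inequality for [Z :&: S], whose neighbours avoid [Z]; so fewer than [#|S|]
   vertices are removed and [#|Z| < #|Z'| <= #|M|]. *)
pose Z' := (Z :\: (S :|: NS)) :|: S.
have iZ' : indep Z'.
  apply: indepU.
  - by apply: indepS iZ; apply: subsetDl.
  - by apply: indepS iA; apply: subset_trans SM MA.
  move=> x y; rewrite in_setD in_setU negb_or => /andP[/andP[xS xNS] xZ] yS.
  have := subsetP ZM x xZ; rewrite inE => /orP[xM|xX].
    by apply: (indepP _ iA); apply: (subsetP MA) => //; apply: (subsetP SM).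
  apply: contra xNS => xy; rewrite inE xX andbT.
  by apply/nbrsP; exists y => //; rewrite adjC.
have Z'M : Z' \subset M :|: X.
  rewrite subUset (subset_trans SM (subsetUl _ _)) andbT.
  by apply: subset_trans ZM; apply: subsetDl.
have leZ' := gM _ Z'M iZ'.
have cZ' : #|Z'| = #|Z| - #|Z :&: (S :|: NS)| + #|S|.
  rewrite cardsU cardsD; have -> : (Z :\: (S :|: NS)) :&: S = set0.
    by apply/setP => x; rewrite !inE; case: (x \in S); rewrite ?andbF.
  by rewrite cards0 subn0.
have le1 : #|Z :&: (S :|: NS)| <= #|Z :&: S| + #|Z :&: NS|.
  by rewrite setIUr cardsU leq_subr.
have le2 : #|Z :&: NS| + #|nbrs (Z :&: S) :&: X| <= #|NS|.
  have -> : nbrs (Z :&: S) :&: X = NS :&: (nbrs (Z :&: S) :&: X).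
    apply/setP => x; rewrite [in RHS]inE; apply/idP/andP => [|[]//] xN; split=> //.
    move: xN; rewrite !in_setI => /andP[/nbrsP[y]]; rewrite inE => /andP[_ yS] yx ->.
    by rewrite andbT; apply/nbrsP; exists y.
  rewrite -(cardsID (nbrs (Z :&: S) :&: X) NS) addnC leq_add2l.
  apply/subset_leq_card/subsetP => x; rewrite (in_setI x Z) in_setD => /andP[xZ ->].
  rewrite andbT in_setI negb_and; apply/orP; left.
  apply/nbrsP => -[y]; rewrite inE => /andP[yZ _].
  by apply/negP; apply: (indepP _ iZ).
have le3 : #|Z :&: S| <= #|nbrs (Z :&: S) :&: X|.
  rewrite leqNgt; apply/negP => bZ; have /setP/(_ s) := minS _ bZ (subsetIr _ _).
  by rewrite inE sS (negPf sZ).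
have le4 : #|Z :&: (S :|: NS)| <= #|Z| by apply: subset_leq_card (subsetIl _ _).
have ltS : #|NS| < #|S| := badS.
have := cardsD1 s M; rewrite sM.
move: leZ' cZ' le1 le2 le3 le4 ltS.
move: #|M| #|M :\ s| #|Z'| #|Z| #|Z :&: (S :|: NS)| #|S| #|Z :&: S| #|Z :&: NS| #|NS|
  #|nbrs (Z :&: S) :&: X|.
clear; lia.
Qed.

End Graph.

(** * Edge bound from a large cyclic family of five independent sets *)

(* The arithmetic end of [pentagon_partition_bound]: [a i] and [b i] are the parts of
   [M i] in [P i.+1] and [P i.+4]; [y], [z], [w] and the capitals are arc counts. *)
Lemma pentagon_arith (y z w p r a b : nat -> nat) (r0 TT PPPP PPT RR : nat) :
    (forall i, p i.+4.+1 = p i) -> (forall i, r i.+4.+1 = r i) -> b 5 = b 0 ->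
    (forall i, y i + z i + p i * a i + p i.+1 * b i.+1
               <= w i + p i * p i.+1 + a i * b i.+1) ->
    (forall i, 2 * (a i * b i.+1) <= 2 * r i.+3 ^ 2 + 4 * (r i.+3 * r0)
               + r0 * ((a i - r i.+3) + (b i.+1 - r i.+3))) ->
    (forall i, (a i - r i.+3) + (b i - r i.+2) <= r0) ->
    \sum_(i < 5) (2 * w i) <= PPPP -> TT + PPPP = 2 * PPT + RR ->
    PPT <= \sum_(i < 5) (y i + z i + p i * (r i + a i + b i)) ->
    RR + \sum_(i < 5) r i ^ 2 <= (\sum_(i < 5) r i + r0) ^ 2 ->
  TT <= \sum_(i < 5) (2 * (p i * p i.+1) + 2 * (p i * r i) + r i ^ 2)
        + (\sum_(i < 5) r i) ^ 2 + 6 * (r0 * \sum_(i < 5) r i) + 6 * r0 ^ 2.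
Proof.
move=> p5 r5 b5 cr ab abr.
have sum_excess : \sum_(i < 5) ((a i - r i.+3) + (b i.+1 - r i.+3)) <= 5 * r0.
  move: (abr 0) (abr 1) (abr 2) (abr 3) (abr 4).
  by rewrite !big_ord_recr !big_ord0 /= !r5 b5; lia.
have : \sum_(i < 5) (2 * (a i * b i.+1)) <= \sum_(i < 5) (2 * r i ^ 2 + 4 * (r i * r0))
    + r0 * (5 * r0).
  apply: leq_trans (_ : \sum_(i < 5) (2 * r i.+3 ^ 2 + 4 * (r i.+3 * r0))
    + r0 * \sum_(i < 5) ((a i - r i.+3) + (b i.+1 - r i.+3)) <= _).
    by rewrite big_distrr -big_split /=; apply: leq_sum => i _; apply: ab.
  apply: leq_add; last by rewrite leq_mul2l sum_excess orbT.
  by rewrite !big_ord_recr !big_ord0 /= !r5; lia.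
move: (cr 0) (cr 1) (cr 2) (cr 3) (cr 4).
rewrite !big_ord_recr !big_ord0 /= !p5 b5 -!mulnn.
clear; move: (p 0) (p 1) (p 2) (p 3) (p 4) (r 0) (r 1) (r 2) (r 3) (r 4)
  (a 0) (a 1) (a 2) (a 3) (a 4) (b 0) (b 1) (b 2) (b 3) (b 4).
move: (y 0) (y 1) (y 2) (y 3) (y 4) (z 0) (z 1) (z 2) (z 3) (z 4)
  (w 0) (w 1) (w 2) (w 3) (w 4).
lia.
Qed.

Section Pentagon.

Variables (T : finType) (E : {set {set T}}).
Local Notation adj := (adjacent E).
Local Notation indep := (independent E).
Local Notation arcs := (arcs E).
Local Notation nbr := (nbr E).
Implicit Types (x y z : T) (B M S X Y Z : {set T}).

Lemma arcsSr X Y Z : Y \subset Z -> arcs X Y <= arcs X Z.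
Proof. by move=> YZ; apply: leq_sum => x _; apply/subset_leq_card/setIS. Qed.

Lemma arcsSl X Y Z : Y \subset Z -> arcs Y X <= arcs Z X.
Proof. by move=> YZ; rewrite ![arcs _ X]arcsC arcsSr. Qed.

(** Inclusion-exclusion: an adjacent pair counted by both terms on the left lies in the product of
    [P :\: M'] and [Q :\: M]. *)
Lemma arcs_cross (P Q M M' : {set T}) :
  arcs P (Q :\: M) + arcs Q (P :\: M') <= arcs P Q + #|P :\: M'| * #|Q :\: M|.
Proof.
rewrite (arcsDr E P Q M) (arcsC E Q) (arcsDr E _ Q M).
have := leq_arcs E (P :\: M') (Q :\: M).
have := @arcsSl (Q :&: M) _ _ (subsetDl P M').
lia.
Qed.

Lemma indep_nbr x : triangle_free E -> indep (nbr x).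
Proof.
move=> tf; apply/indepP => y z; rewrite !in_nbr => xy xz; apply/negP => yz.
move/existsP: tf; apply; exists x; apply/existsP; exists y; apply/existsP; exists z.
by rewrite xy yz xz.
Qed.

Variable A : nat -> {set T}.
Hypothesis tf : triangle_free E.
Hypothesis A5 : forall i, A i.+4.+1 = A i.
Hypothesis iA : forall i, indep (A i).
Hypothesis dA : forall i, [disjoint A i & A i.+1].
Hypothesis maxA : forall i Z, indep Z -> [disjoint Z & A i.+1] ->
  [disjoint Z & A i.+4] -> #|Z| <= #|A i|.

Let P i := A i.+1 :&: A i.+4.
Let R i := A i :\: (A i.+2 :|: A i.+3).
Let R0 := ~: \bigcup_(i < 5) A i.
(** Here [i.+4] stands for i - 1 modulo 5. [A i :|: X i] consists of the vertices outside both
    cyclic neighbours of [A i], exactly the range where [maxA] applies. *)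
Let X i := ~: (A i :|: A i.+1 :|: A i.+4).
Let PP := \bigcup_(i < 5) P i.
Let RR := ~: PP.

Let exclA i x : (x \in A i) && (x \in A i.+1) = false.
Proof. by apply/negP => /andP[xA]; rewrite (disjointFr (dA i)). Qed.

Let exclA4 i x : (x \in A i) && (x \in A i.+4) = false.
Proof. by rewrite andbC -(A5 i) exclA. Qed.

Let A_mod i : A (i %% 5) = A i.
Proof.
rewrite {2}(divn_eq i 5); elim: (i %/ 5) => [|k IH]; first by rewrite add0n.
by rewrite IH -[LHS]A5; congr A; rewrite mulSn addnC; lia.
Qed.

(** Consecutive sets are disjoint, so a vertex lies in at most two of the five, and then in two at
    cyclic distance two. The 0-1 form lets weighted sums split by exchanging summations. *)
Let mem5 x : [/\ (x \in PP : nat) = \sum_(i < 5) (x \in P i),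
  (x \in RR : nat) = \sum_(i < 5) (x \in R i) + (x \in R0) &
  forall i, (x \in A i : nat) = (x \in P i.+1) + (x \in P i.+4) + (x \in R i)].
Proof.
have [e0 e1 e2] := And3 (exclA 0 x) (exclA 1 x) (exclA 2 x).
have [e3 e4] := conj (exclA 3 x) (exclA4 0 x).
split.
- rewrite /PP !big_ord_recr !big_ord0 /= /P !A5 !inE.
  by move: e0 e1 e2 e3 e4; move: (x \in A 0) (x \in A 1) (x \in A 2) (x \in A 3)
    (x \in A 4) => [] [] [] [] [].
- rewrite /RR /PP /R0 !big_ord_recr !big_ord0 /= /P /R !A5 !inE.
  by move: e0 e1 e2 e3 e4; move: (x \in A 0) (x \in A 1) (x \in A 2) (x \in A 3)
    (x \in A 4) => [] [] [] [] [].
move=> i; rewrite /P /R !A5 !inE; have := exclA i.+2 x.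
by case: (x \in A i); case: (x \in A i.+2); case: (x \in A i.+3).
Qed.

Let sumPP (F : T -> nat) : \sum_(x in PP) F x = \sum_(i < 5) \sum_(x in P i) F x.
Proof.
rewrite big_mkcond (eq_bigr (fun i : 'I_5 => \sum_x (x \in P i) * F x)); last first.
  by move=> i _; rewrite big_mkcond; apply: eq_bigr => x _; case: ifP; rewrite ?mul1n.
rewrite exchange_big /=; apply: eq_bigr => x _; rewrite -big_distrl /=.
by have [<- _ _] := mem5 x; case: (x \in PP); rewrite ?mul1n.
Qed.

Let sumRR (F : T -> nat) :
  \sum_(x in RR) F x = \sum_(i < 5) \sum_(x in R i) F x + \sum_(x in R0) F x.
Proof.
rewrite big_mkcond (eq_bigr (fun i : 'I_5 => \sum_x (x \in R i) * F x)); last first.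
  by move=> i _; rewrite big_mkcond; apply: eq_bigr => x _; case: ifP; rewrite ?mul1n.
rewrite exchange_big /= [X in _ = _ + X]big_mkcond -big_split; apply: eq_bigr => x _ /=.
rewrite -big_distrl /=; have [_ /esym + _] := mem5 x.
by move: (\sum_(i < 5) _) (x \in RR) (x \in R0) => n [] [] ? ; lia.
Qed.

Let cardA i : #|A i| = #|P i.+1| + #|P i.+4| + #|R i|.
Proof.
rewrite -!sum1_card !(big_mkcond (fun x => x \in _)) -!big_split; apply: eq_bigr => x _ /=.
have [_ _ /(_ i)] := mem5 x.
by case: (x \in A i); case: (x \in P i.+1); case: (x \in P i.+4); case: (x \in R i).
Qed.

Let cardRR : #|RR| = \sum_(i < 5) #|R i| + #|R0|.
Proof. by rewrite -sum1_card sumRR sum1_card; under eq_bigr do rewrite sum1_card. Qed.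

Let cardT : #|T| = \sum_(i < 5) (#|P i| + #|R i|) + #|R0|.
Proof.
rewrite -(cardsC PP) -/RR cardRR addnA big_split -sum1_card sumPP /=.
by under eq_bigr do rewrite sum1_card.
Qed.

(** Each [R i] is independent, so the neighbours in [RR] of a vertex of [R i] all lie outside
    [R i]. *)
Let arcsRR : arcs RR RR + \sum_(i < 5) #|R i| ^ 2 <= #|RR| ^ 2.
Proof.
have subRR (i : 'I_5) : R i \subset RR.
  apply/subsetP => x xR; have [_ + _] := mem5 x.
  by rewrite (bigD1 i) //= xR; case: (x \in RR).
rewrite /arcs sumRR -addnA [X in _ + X]addnC addnA -big_split /= expnS expn1.
rewrite {1}cardRR mulnDl big_distrl /=; apply: leq_add.
  apply: leq_sum => i _; rewrite -mulnn -!sum_nat_const -big_split /=.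
  apply: leq_sum => x xR; rewrite -cardsUI (_ : _ :&: _ :&: _ = set0).
    by rewrite cards0 addn0 subset_leq_card // subUset subsetIr subRR.
  apply/setP => y; rewrite !in_setI in_set0; apply/negP => /andP[/andP[xy _] yR].
  move: xy xR yR; rewrite in_nbr !in_setD => xy /andP[_ xA] /andP[_ yA].
  by move/indepP: (iA i) => /(_ x y xA yA); rewrite xy.
by rewrite -sum_nat_const; apply: leq_sum => x _; apply/subset_leq_card/subsetIr.
Qed.

Let coreP : exists M : nat -> {set T}, [/\ forall i, M i.+4.+1 = M i,
  forall i, M i \subset A i,
  forall i Z, Z \subset M i :|: X i -> indep Z -> #|Z| <= #|M i| &
  forall i S, S \subset M i -> #|S| <= #|nbrs E S :&: X i|].
Proof.
have [i|M0 M0P] := @fin_all_exists 'I_5 (fun _ => {set T}) (fun i M => [/\ M \subset A i,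
    forall Z, Z \subset M :|: X i -> indep Z -> #|Z| <= #|M| &
    forall S, S \subset M -> #|S| <= #|nbrs E S :&: X i|]).
  have dAX : [disjoint A i & X i].
    rewrite -setI_eq0; apply/eqP/setP => x; rewrite !inE.
    by case: (x \in A i).
  have [Z ZAX iZ|M MA [M1 M2]] := hall_core (iA i) dAX; last by exists M.
  apply: maxA => //; rewrite -setI_eq0; apply/eqP/setP => x; rewrite !inE;
    apply/negP => /andP[/(subsetP ZAX)]; rewrite !inE => /orP[xA|].
  - by move=> xA1; have := exclA i x; rewrite xA xA1.
  - by rewrite !negb_or => /andP[/andP[_ /negPf ->]].
  - by move=> xA1; have := exclA4 i x; rewrite xA xA1.
  - by rewrite !negb_or => /andP[_ /negPf ->].
(* The five cores are chosen together and then extended periodically. *)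
pose o5 i : 'I_5 := inord (i %% 5).
have Ao5 i : A (o5 i) = A i by rewrite inordK ?ltn_mod // A_mod.
have Xo5 i : X (o5 i) = X i.
  have s1 k : A (i %% 5 + k) = A (i + k) by rewrite -A_mod modnDml A_mod.
  by rewrite /X inordK ?ltn_mod // A_mod -(addn4 (_ %% _)) -(addn1 (_ %% _)) !s1 addn1 addn4.
exists (fun i => M0 (o5 i)); split=> i.
- by rewrite /o5; congr (M0 (inord _)); rewrite -(modnDr i 5); congr (_ %% _); lia.
- by have [] := M0P (o5 i); rewrite Ao5.
- by have [_ + _] := M0P (o5 i); rewrite Xo5.
- by have [_ _] := M0P (o5 i); rewrite Xo5.
Qed.

Let arcs_shift (F : nat -> nat) : F 5 = F 0 -> \sum_(i < 5) F i = \sum_(i < 5) F i.+1.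
Proof. by move=> F5; rewrite !big_ord_recr !big_ord0 /= F5; lia. Qed.

Let disjA_nbr i x : x \in A i -> nbr x :&: A i = set0.
Proof.
move=> xA; apply/setP => y; rewrite !inE; apply/negP => /andP[xy yA].
by move/indepP: (iA i) => /(_ x y xA yA); rewrite xy.
Qed.

Let inR0 i x : (x \in R0) =
  [&& x \notin A i, x \notin A i.+1, x \notin A i.+2, x \notin A i.+3 & x \notin A i.+4].
Proof.
rewrite inE; apply/idP/and5P => [/bigcupP nA|[n0 n1 n2 n3 n4]].
  by split; apply/negP => xA; apply: nA;
    [exists (inord (i %% 5)) | exists (inord (i.+1 %% 5)) | exists (inord (i.+2 %% 5))
    | exists (inord (i.+3 %% 5)) | exists (inord (i.+4 %% 5))];
    rewrite // inordK ?ltn_mod // A_mod.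
apply/bigcupP => -[k _ xA].
have : (k == i %% 5 :> nat) || (k == i.+1 %% 5 :> nat) || (k == i.+2 %% 5 :> nat)
    || (k == i.+3 %% 5 :> nat) || (k == i.+4 %% 5 :> nat).
  by have := ltn_ord k; lia.
by rewrite -!orbA; case/or4P=> [|||/orP[]] /eqP kE; move: xA; rewrite kE A_mod; apply/negP.
Qed.

Let subPP i : P i \subset PP.
Proof.
have s1 k : A (i %% 5 + k) = A (i + k) by rewrite -A_mod modnDml A_mod.
have -> : P i = P (i %% 5).
  by rewrite /P -(addn4 (_ %% _)) -(addn1 (_ %% _)) !s1 addn1 addn4.
exact: (bigcup_sup (Ordinal (ltn_pmod i (isT : 0 < 5)))).
Qed.

Let dP i : [disjoint P i.+1 & P i.+4].
Proof.
rewrite -setI_eq0; apply/eqP/setP => x; rewrite !inE !A5.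
have := exclA i.+2 x.
by case: (x \in A i.+2); case: (x \in A i.+3); rewrite ?andbF.
Qed.

(* The sets [A i] are cyclic with period 5; [p i], [r i] and [r0] count the vertices
   lying in both [A i.-1] and [A i.+1], in [A i] only, and in no [A i]. With [M i] a
   core of [A i] given by [hall_core], [p] in [P i] has at most as many neighbours
   outside [A i] as non-neighbours in [M i]; only the missing pairs between
   [M i] and [M i.+1] get counted twice. *)
Lemma pentagon_partition_bound : exists p r : nat -> nat, exists r0,
  [/\ forall i, (p i.+4.+1 = p i) * (r i.+4.+1 = r i),
      forall i, #|A i| = p i.+1 + p i.+4 + r i,
      #|T| = \sum_(i < 5) (p i + r i) + r0 &
      arcs setT setT <= \sum_(i < 5) (2 * (p i * p i.+1) + 2 * (p i * r i) + r i ^ 2)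
        + (\sum_(i < 5) r i) ^ 2 + 6 * (r0 * \sum_(i < 5) r i) + 6 * r0 ^ 2].
Proof.
have [M [M5 MA Mmax Mhall]] := coreP.
have P5 i : P i.+4.+1 = P i by rewrite /P !A5.
have R5 i : R i.+4.+1 = R i by rewrite /R !A5.
exists (fun i => #|P i|), (fun i => #|R i|), #|R0|; split=> [i|//|//|]; first by rewrite P5 R5.
pose a i := #|M i :&: P i.+1|; pose b i := #|M i :&: P i.+4|.
(* [nbr x] avoids [A i.+1] and [A i.+4]. Its part in [X i :|: M i] is independent, hence at most
   [#|M i|]; the rest lies in [A i :\: M i], split along [P i.+1], [P i.+4] and [R i]. *)
have degP i x : x \in P i -> #|nbr x| <= #|nbr x :&: (P i.+1 :\: M i)|
    + #|nbr x :&: (P i.+4 :\: M i)| + (#|R i| + a i + b i).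
  rewrite inE => /andP[xA1 xA4].
  have le1 : #|nbr x :&: (X i :|: M i)| <= #|M i|.
    apply: Mmax; first by rewrite setUC subsetIr.
    by apply: indepS (subsetIl _ _) (indep_nbr x tf).
  have AE : A i = P i.+1 :|: P i.+4 :|: R i.
    apply/setP => y; have [_ _ /(_ i)] := mem5 y; rewrite in_setU (in_setU y).
    by case: (y \in A i); case: (y \in P i.+1); case: (y \in P i.+4); case: (y \in R i).
  have ME : #|M i| <= a i + b i + #|R i :&: M i|.
    rewrite -{1}(setIidPl (MA i)) AE !setIUr [M i :&: R i]setIC.
    by rewrite (leq_trans (leq_card_setU _ _)) // leq_add2r leq_card_setU.
  have sub : nbr x \subset (nbr x :&: (X i :|: M i)) :|: (nbr x :&: (P i.+1 :\: M i))
      :|: (nbr x :&: (P i.+4 :\: M i)) :|: (R i :\: M i).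
    apply/subsetP => y xy; have /setP/(_ y) := disjA_nbr xA1; have /setP/(_ y) := disjA_nbr xA4.
    have /setP/(_ y) := AE; move: xy; rewrite !inE => ->.
    by case: (y \in A i); case: (y \in A i.+1); case: (y \in A i.+4); case: (y \in M i) => //=.
  have := subset_leq_card sub; have := cardsID (M i) (R i).
  have := leq_card_setU (nbr x :&: (X i :|: M i)) (nbr x :&: (P i.+1 :\: M i)).
  set B1 := _ :|: (nbr x :&: (P i.+1 :\: M i)).
  have := leq_card_setU B1 (nbr x :&: (P i.+4 :\: M i)); set B2 := B1 :|: _.
  have := leq_card_setU B2 (R i :\: M i).
  move=> [+ _] [+ _] [+ _]; move: le1 ME; clear; lia.
have arcsP i : arcs (P i) setT <= arcs (P i) (P i.+1 :\: M i) + arcs (P i) (P i.+4 :\: M i)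
    + #|P i| * (#|R i| + a i + b i).
  rewrite /arcs -sum_nat_const -!big_split /=; apply: leq_sum => x xP.
  by rewrite setIT; apply: degP.
(* This is [arcs_cross] with the product (p - b)(q - a) expanded; [b i.+1] measures [M i.+1] inside
   [P i]. *)
have crossP i : arcs (P i) (P i.+1 :\: M i) + arcs (P i.+1) (P i :\: M i.+1)
    + #|P i| * a i + #|P i.+1| * b i.+1
    <= arcs (P i) (P i.+1) + #|P i| * #|P i.+1| + a i * b i.+1.
  have := arcs_cross (P i) (P i.+1) (M i) (M i.+1).
  rewrite /a /b P5.
  rewrite -(cardsID (M i.+1) (P i)) -(cardsID (M i) (P i.+1)) ![M _ :&: _]setIC.
  move: (arcs _ _) (arcs _ _) (arcs _ _) #|_| #|_| #|_| #|_| => u v w p1 p2 q1 q2.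
  nia.
(* Neighbours in [X i] of a vertex of [P i.+1] also avoid [A i.+2], so among the five sets they can
   lie only in [A i.+3]. The bound on [b i] is symmetric. *)
have aR i : a i <= #|R i.+3| + #|R0|.
  apply: leq_trans (Mhall i _ (subsetIl _ _)) _.
  apply: leq_trans (leq_card_setU _ _); apply/subset_leq_card/subsetP => y.
  rewrite inE => /andP[/nbrsP[z]]; rewrite in_setI => /andP[_ /setIP[zA _]] zy.
  have /setP/(_ y) := disjA_nbr zA; rewrite in_setU (inR0 i) !inE zy !A5 /=.
  by case: (y \in A i); case: (y \in A i.+1); case: (y \in A i.+4); case: (y \in A i.+2);
    case: (y \in A i.+3).
have bR i : b i <= #|R i.+2| + #|R0|.
  apply: leq_trans (Mhall i _ (subsetIl _ _)) _.
  apply: leq_trans (leq_card_setU _ _); apply/subset_leq_card/subsetP => y.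
  rewrite inE => /andP[/nbrsP[z]]; rewrite in_setI => /andP[_ /setIP[_ zA]] zy.
  rewrite A5 in zA.
  have /setP/(_ y) := disjA_nbr zA; rewrite in_setU (inR0 i) !inE zy !A5 /=.
  by case: (y \in A i); case: (y \in A i.+1); case: (y \in A i.+4); case: (y \in A i.+2);
    case: (y \in A i.+3).
have abR i : a i + b i <= #|R i.+3| + #|R i.+2| + #|R0|.
  have -> : a i + b i = #|(M i :&: P i.+1) :|: (M i :&: P i.+4)|.
    rewrite cardsU (_ : _ :&: _ :&: (_ :&: _) = set0) ?cards0 ?subn0 //; apply/setP => y.
    rewrite [RHS]inE -setIIr inE; apply/negP => /andP[_ /setIP[yP yP']].
    by have := disjointFr (dP i) yP; rewrite yP'.
  apply: leq_trans (Mhall i _ _) _; first by rewrite subUset !subsetIl.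
  apply: leq_trans (_ : #|R i.+3 :|: R i.+2 :|: R0| <= _).
    apply/subset_leq_card/subsetP => y; rewrite !in_setU (inR0 i) inE => /andP[_].
    have := exclA i.+2 y; rewrite !inE !A5.
    by case: (y \in A i); case: (y \in A i.+1); case: (y \in A i.+4); case: (y \in A i.+2);
      case: (y \in A i.+3).
  by rewrite (leq_trans (leq_card_setU _ _)) // leq_add2r leq_card_setU.
(* Both factors are expanded around r = [#|R i.+3|]; their excesses over r are at most [#|R0|],
   which bounds the mixed terms. *)
have abM i : 2 * (a i * b i.+1) <= 2 * #|R i.+3| ^ 2 + 4 * (#|R i.+3| * #|R0|)
    + #|R0| * ((a i - #|R i.+3|) + (b i.+1 - #|R i.+3|)).
  have := aR i; have := bR i.+1; move: (a i) (b i.+1) #|R i.+3| #|R0|; clear => u v w k.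
  have [alpha] : exists d, d = u - w by exists (u - w).
  have [beta] : exists d, d = v - w by exists (v - w).
  move=> eb ea kv ku; rewrite -ea -eb.
  have ua : u <= w + alpha by lia.
  have vb : v <= w + beta by lia.
  have ak : alpha <= k by lia.
  have bk : beta <= k by lia.
  apply: leq_trans (_ : 2 * ((w + alpha) * (w + beta)) <= _).
    by rewrite leq_mul2l leq_mul.
  have := leq_mul ak (leqnn beta); have := leq_mul bk (leqnn alpha).
  have := leq_mul ak (leqnn w); have := leq_mul bk (leqnn w).
  nia.
have abS i : (a i - #|R i.+3|) + (b i - #|R i.+2|) <= #|R0|.
  have := aR i; have := bR i; have := abR i; clear; lia.
have PPge : \sum_(i < 5) (2 * arcs (P i) (P i.+1)) <= arcs PP PP.
  rewrite [leqRHS]sumPP.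
  have -> : \sum_(i < 5) (2 * arcs (P i) (P i.+1))
      = \sum_(i < 5) arcs (P i) (P i.+1) + \sum_(i < 5) arcs (P i) (P i.+4).
    rewrite (@arcs_shift (fun i => arcs (P i) (P i.+4))) ?P5 // -big_split.
    by apply: eq_bigr => i _ /=; rewrite P5 [arcs (P i.+1) _]arcsC mul2n addnn.
  rewrite -big_split; apply: leq_sum => i _ /=.
  by rewrite -arcsUr ?arcsSr // subUset !subPP.
have TT : arcs setT setT + arcs PP PP = 2 * arcs PP setT + arcs RR RR.
  have dPR : [disjoint PP & RR] by rewrite -setI_eq0 setICr.
  have TE : setT = PP :|: RR by rewrite setUCr.
  rewrite TE !(arcsUl, arcsUr) // [arcs RR PP]arcsC; lia.
(* Reindexing puts both counts between [P i] and [P i.+1] into one summand, where [crossP] bounds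
   their sum. *)
have S1 : \sum_(i < 5) arcs (P i) (P i.+4 :\: M i)
    = \sum_(i < 5) arcs (P i.+1) (P i :\: M i.+1).
  rewrite (@arcs_shift (fun i => arcs (P i) (P i.+4 :\: M i))) ?P5 ?M5 //.
  by apply: eq_bigr => i _; rewrite P5.
have PPT : arcs PP setT <= \sum_(i < 5) (arcs (P i) (P i.+1 :\: M i)
    + arcs (P i.+1) (P i :\: M i.+1) + #|P i| * (#|R i| + a i + b i)).
  rewrite /arcs sumPP !big_split -S1 -!big_split /=; apply: leq_sum => i _.
  exact: arcsP.
have := arcsRR; rewrite cardRR.
have b5 : b 5 = b 0 by rewrite /b P5 M5.
apply: (@pentagon_arith (fun i => arcs (P i) (P i.+1 :\: M i))
  (fun i => arcs (P i.+1) (P i :\: M i.+1)) (fun i => arcs (P i) (P i.+1))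
  (fun i => #|P i|) (fun i => #|R i|) a b _ _ _ _ _ _ _ b5 crossP abM abS PPge TT PPT) => i.
- by rewrite P5.
- by rewrite R5.
Qed.

End Pentagon.

(* The bound exceeds the left-hand side by twice [h (d - h)] plus products of
   nonnegative terms, where [d = 8 s - 3 n] and [h] is the total defect [5 s - sum a]. *)
Lemma pentagon_numeric (p r a : nat -> nat) (r0 n s TT : nat) :
    (forall i, (p i.+4.+1 = p i) * (r i.+4.+1 = r i)) ->
    (forall i, a i = p i.+1 + p i.+4 + r i) -> (forall i, a i <= s) ->
    n = \sum_(i < 5) (p i + r i) + r0 -> 3 * n <= \sum_(i < 5) a i + 3 * s ->
    TT <= \sum_(i < 5) (2 * (p i * p i.+1) + 2 * (p i * r i) + r i ^ 2)
        + (\sum_(i < 5) r i) ^ 2 + 6 * (r0 * \sum_(i < 5) r i) + 6 * r0 ^ 2 ->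
  TT + 30 * (n * s) <= 6 * n ^ 2 + 40 * s ^ 2.
Proof.
move=> pr aE; rewrite !big_ord_recr !big_ord0 /= -!mulnn => as_; rewrite !aE !pr => nE.
have [[[[s0 s1] s2] s3] s4] := (as_ 0, as_ 1, as_ 2, as_ 3, as_ 4).
move: s0 s1 s2 s3 s4; rewrite nE !aE !pr; clear as_ aE nE pr a.
move: (p 0) (p 1) (p 2) (p 3) (p 4) (r 0) (r 1) (r 2) (r 3) (r 4).
clear => p0 p1 p2 p3 p4 q0 q1 q2 q3 q4 s0 s1 s2 s3 s4 dge.
have prod_ge0 (x y z t : nat) : x <= z -> y <= t -> (0 <= (z%:Z - x%:Z) * (t%:Z - y%:Z))%R.
  by move=> xz yt; nia.
(* The slacks [s - a i] of sets at cyclic distance two are multiplied; the further product below is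
   h (d - h). *)
have := (prod_ge0 _ _ _ _ s0 s2, prod_ge0 _ _ _ _ s1 s3, prod_ge0 _ _ _ _ s2 s4,
  prod_ge0 _ _ _ _ s3 s0, prod_ge0 _ _ _ _ s4 s1).
have h_ge := leq_add (leq_add (leq_add (leq_add s0 s1) s2) s3) s4.
have := prod_ge0 _ _ _ _ h_ge dge.
move=> H [[[[H0 H1] H2] H3] H4].
clear s0 s1 s2 s3 s4 h_ge dge prod_ge0.
have G := leq0n (q0 * q1 + q1 * q2 + q2 * q3 + q3 * q4 + q4 * q0).
lia.
Qed.

Section PentagonPattern.

Variables (T : finType) (E : {set {set T}}) (s : nat).
Local Notation indep := (independent E).
Hypothesis tf : triangle_free E.
Hypothesis le_s : forall Z, indep Z -> #|Z| <= s.

(** Passing to a family of largest total size keeps the size condition and yields the maximality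
    that [pentagon_partition_bound] needs: replacing one set by some [Z] disjoint from its two
    cyclic neighbours gives another valid family. *)
Lemma pentagon_bound (A : nat -> {set T}) :
    (forall i, A i.+4.+1 = A i) -> (forall i, indep (A i)) ->
    (forall i, [disjoint A i & A i.+1]) ->
    3 * #|T| <= \sum_(i < 5) #|A i| + 3 * s ->
  arcs E setT setT + 30 * (#|T| * s) <= 6 * #|T| ^ 2 + 40 * s ^ 2.
Proof.
move=> A5 iA dA sumA.
(* Families become finite functions so that a maximum exists; [ext] reads them periodically. *)
pose ext (f : {ffun 'I_5 -> {set T}}) i : {set T} := f (inord (i %% 5)).
pose valid f := [forall i : 'I_5, indep (ext f i) && [disjoint ext f i & ext f i.+1]].
have ext5 f i : ext f i.+4.+1 = ext f i.
  by rewrite /ext; congr (f (inord _)); rewrite -(modnDr i 5); congr (_ %% _); lia.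
have ext_mod f i : ext f (i %% 5) = ext f i by rewrite /ext modn_mod.
have ext_modS f i : ext f (i %% 5).+1 = ext f i.+1.
  by rewrite /ext; congr (f (inord _)); lia.
have validP f : reflect (forall i, indep (ext f i) /\ [disjoint ext f i & ext f i.+1]) (valid f).
  apply: (iffP forallP) => [H i|H i]; last by have [-> ->] := H i.
  have := H (Ordinal (ltn_pmod i (isT : 0 < 5))); rewrite /= ext_mod ext_modS.
  by move/andP.
have A_mod i : A (i %% 5) = A i.
  rewrite {2}(divn_eq i 5); elim: (i %/ 5) => [|k IH]; first by rewrite add0n.
  by rewrite IH -[LHS]A5; congr A; rewrite mulSn addnC; lia.
pose f0 := [ffun i : 'I_5 => A i].
have f0E i : ext f0 i = A i by rewrite /ext ffunE inordK ?ltn_mod // A_mod.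
have v0 : valid f0 by apply/validP => i; rewrite !f0E.
have [f /validP vf maxf] := @arg_maxnP _ f0 valid (fun f => \sum_(i < 5) #|ext f i|) v0.
have [i|i|i Z iZ dZ1 dZ4|p [r [r0 [pr aE nE TTle]]]] :=
    @pentagon_partition_bound _ E (ext f) tf (ext5 f).
- by have [] := vf i.
- by have [] := vf i.
- pose g := [ffun j : 'I_5 => if j == inord (i %% 5) then Z else f j].
  have gE j : ext g j = if j %% 5 == i %% 5 then Z else ext f j.
    by rewrite /ext ffunE -val_eqE /= !inordK ?ltn_mod.
  have vg : valid g.
    apply/validP => j; rewrite !gE; have [vj dj] := vf j.
    have [ji|ji] := eqVneq (j %% 5) (i %% 5); have [ji1|ji1] := eqVneq (j.+1 %% 5) (i %% 5).
    - by exfalso; lia.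
    - split=> //; suff -> : ext f j.+1 = ext f i.+1 by [].
      by rewrite -ext_modS ji ext_modS.
    - split=> //; rewrite disjoint_sym; suff -> : ext f j = ext f i.+4 by [].
      by rewrite -ext_mod -(ext_mod f i.+4); congr ext; lia.
    - by [].
  pose i0 : 'I_5 := inord (i %% 5).
  have splitF h : \sum_(j < 5) #|ext h j| = #|ext h i| + \sum_(j < 5 | j != i0) #|ext h j|.
    by rewrite (bigD1 i0) //= inordK ?ltn_mod // ext_mod.
  have := maxf g vg; rewrite /= !splitF gE eqxx.
  rewrite (eq_bigr (fun j : 'I_5 => #|ext f j|)) ?leq_add2r // => j.
  rewrite -val_eqE /= inordK ?ltn_mod // gE => /negPf ji.
  by rewrite (modn_small (ltn_ord j)) ji.
apply: (pentagon_numeric pr aE _ nE _ TTle) => [i|].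
  by apply: le_s; have [] := vf i.
apply: leq_trans sumA _; rewrite leq_add2r.
have := maxf _ v0; rewrite /= (eq_bigr (fun i : 'I_5 => #|A i|)) // => i _.
by rewrite f0E.
Qed.

End PentagonPattern.

(** * Lower bound on the total deficiency by averaging over thresholds *)

Lemma count_window K m d : \sum_(i < K) (m < i.+1 <= m + d) <= d.
Proof.
suff -> : \sum_(i < K) (m < i.+1 <= m + d) = minn K (m + d) - minn K m by lia.
elim: K => [|K IH]; first by rewrite big_ord0; lia.
by rewrite big_ord_recr /= IH; lia.
Qed.

Lemma count_window_rev K m d : \sum_(i < K) (m < K - i <= m + d) <= d.
Proof.
apply: leq_trans (count_window K m d); rewrite (reindex_inj rev_ord_inj) /=.
by apply: leq_sum => i _; rewrite subKn.
Qed.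

Section Deficiency.

Variables (T : finType) (E : {set {set T}}) (s : nat) (A : {set T}).
Local Notation adj := (adjacent E).
Local Notation indep := (independent E).
Local Notation nbr := (nbr E).
Local Notation n := #|T|.
Hypothesis tf : triangle_free E.
Hypothesis le_s : forall Z, indep Z -> #|Z| <= s.
Hypotheses (iA : indep A) (cA : #|A| = s).

Let def v := s - #|nbr v|.
(** This is the quantity d of the overview. *)
Let K := 8 * s - 3 * n.
Let x := 2 * n - 5 * s.
Hypotheses (Kgt0 : 3 * n < 8 * s) (xgt0 : 5 * s < 2 * n).
Hypothesis path_def : forall a b b' a', a \in A -> a' \in A -> b \notin A -> b' \notin A ->
  adj a b -> adj b b' -> adj b' a' -> K <= def a + def b + def b' + def a'.

Let nbrE v : #|nbr v| + def v = s.
Proof. by rewrite /def subnKC // le_s // indep_nbr. Qed.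

(** Otherwise [b |: A] would be independent with s + 1 elements. *)
Let nbrA b : b \notin A -> exists2 a, a \in A & adj a b.
Proof.
move=> bA; apply/exists_inP; apply: contraLR (leqnn s) => /exists_inPn nb.
rewrite -ltnNge -cA; have -> : #|A|.+1 = #|b |: A| by rewrite cardsU1 bA.
rewrite cA; apply: le_s; apply/indepP => y z /setU1P[->|yA] /setU1P[->|zA].
- apply/negP => bb; move/existsP: tf; apply.
  by exists b; apply/existsP; exists b; apply/existsP; exists b; rewrite bb.
- by rewrite adjC nb.
- by rewrite nb.
- by apply: (indepP _ _ iA).
Qed.

(** Adjacent vertices have disjoint neighbourhoods, since there is no triangle. *)
Let card_nbrU b b' (Z : {set T}) : adj b b' -> nbr b \subset Z -> nbr b' \subset Z ->
  2 * s <= #|Z| + def b + def b'.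
Proof.
move=> bb' bZ b'Z; have : #|nbr b :|: nbr b'| <= #|Z|.
  by rewrite subset_leq_card // subUset bZ.
rewrite cardsU (_ : _ :&: _ = set0); last first.
  apply/setP => y; rewrite !inE; apply/negP => /andP[by_ b'y].
  have /indepP/(_ b' y) := indep_nbr b tf; rewrite !in_nbr b'y.
  by move/(_ bb' by_).
by rewrite cards0; have := nbrE b; have := nbrE b'; lia.
Qed.

Section Threshold.

(** The two hypotheses below make [m b] the least deficiency of a neighbour of [b] in [A], that is,
    of the cheapest end of a path through [b]. *)
Variable m : T -> nat.
Hypothesis m_le : forall b a, b \notin A -> a \in A -> adj a b -> m b <= def a.
Hypothesis m_att : forall b, b \notin A -> exists a, [/\ a \in A, adj a b & m b = def a].

Let th b := m b + def b.
Let al t := #|[set a in A | t <= def a]|.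
(** The vertices outside [A] that the rounding has to pay for. For any other vertex outside [A],
    [m b] and [th b] lie on the same side of each threshold. *)
Let B l u := [set b in ~: A | [|| K <= 2 * def b, m b < l <= th b | m b < u <= th b]].

Let edge_th b b' : b \notin A -> b' \notin A -> adj b b' -> K <= th b + th b'.
Proof.
move=> bA b'A bb'; have [a [aA ab ma]] := m_att bA; have [a' [a'A]] := m_att b'A.
rewrite adjC /th ma => b'a' ->; have := path_def aA a'A bA b'A ab bb' b'a'; lia.
Qed.

(* Rounding deficiencies at the two thresholds [l] and [u = K + 1 - l] gives values
   0, 1/2 or 1; [al l + al u + #|B l u|] is at most twice the cost of the rounding. *)
Let cost_ge l u : 0 < l <= u -> l + u = K.+1 -> 2 * x <= al l + al u + #|B l u|.
Proof.
move=> /andP[l0 lu] luK; rewrite leqNgt; apply/negP => cost.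
pose Y := ~: A; pose Bs := B l u.
pose Y0 := [set b in Y :\: Bs | m b < l].
pose Yh := [set b in Y :\: Bs | l <= m b < u].
pose Y1 := [set b in Y :\: Bs | u <= m b].
pose Al := [set a in A | l <= def a]; pose Au := [set a in A | u <= def a].
have YBP b : b \in Y :\: Bs -> [/\ b \notin A, 2 * def b < K,
    m b < l -> th b < l & m b < u -> th b < u].
  rewrite !inE negb_and !negb_or => /andP[/orP[/negP|] + bA]; rewrite bA //.
  by rewrite -!ltnNge /th => /and3P[]; split=> //; lia.
have cY : #|Y| + s = n by rewrite -cA addnC cardsC.
have cYB : #|Y0| + #|(Y :\: Bs) :\: Y0| + #|Bs| = #|Y|.
  rewrite -[in RHS](cardsID Bs Y) (setIidPr _); last first.
    by apply/subsetP => b; rewrite inE => /andP[].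
  rewrite -[in RHS](cardsID Y0 (Y :\: Bs)) (setIidPr _) 1?addnC //.
  by apply/subsetP => b; rewrite inE => /andP[].
have al_lu : al u <= al l.
  by apply/subset_leq_card/subsetP => a; rewrite !inE => /andP[-> /=]; apply: leq_trans.
have nbrA_high b t : b \notin A -> t <= m b -> nbr b :&: A \subset [set a in A | t <= def a].
  move=> bA tm; apply/subsetP => a; rewrite !inE adjC => /andP[ab aA].
  by rewrite aA (leq_trans tm) // m_le.
(* An edge inside [Y1] has all its neighbours in [Y :|: Au], so [al u] exceeds 3 s - n - K = x, and
   [al l >= al u] contradicts [cost]. *)
have Y1_indep : indep Y1.
  apply/indepP => b b' /setIdP[/YBP[bA db _ _] ub] /setIdP[/YBP[b'A db' _ _] ub'].
  apply/negP => bb'.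
  have sub c : c \notin A -> u <= m c -> nbr c \subset Y :|: Au.
    move=> cA' uc; apply/subsetP => a ca; rewrite in_setU [a \in Y]inE orbC.
    by case aA: (a \in A); rewrite ?orbT // (subsetP (nbrA_high c u cA' uc)) // inE ca.
  have := card_nbrU bb' (sub _ bA ub) (sub _ b'A ub').
  have [+ _] := leq_card_setU Y Au; rewrite -/(al u).
  move: cost Kgt0 xgt0 al_lu cY db db'; rewrite /x /K; clear; lia.
(* The two values [th] are at most l - 1 and u - 1, with sum K - 1, against [edge_th]. *)
have low_high b b' : b \in Y :\: Bs -> b' \in Y :\: Bs -> m b < l -> m b' < u -> ~~ adj b b'.
  move=> /YBP[bA _ bl _] /YBP[b'A _ _ b'u] mb mb'; apply/negP => bb'.
  have := edge_th bA b'A bb'; have := bl mb; have := b'u mb'; move: luK; clear; lia.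
(* An edge inside [Yh] has no neighbour in [Y0], which bounds [al l + #|Y| - #|Y0|] from below. Some
   [a] in [A] has deficiency below l, and its neighbours lie in [Y0 :|: Bs]; adding the two bounds
   contradicts [cost]. *)
have Yh_indep : indep Yh.
  apply/indepP => b b' /setIdP[bY /andP[lb bu]] /setIdP[b'Y /andP[lb' b'u]].
  apply/negP => bb'.
  have [[bA db _ _] [b'A db' _ _]] := (YBP _ bY, YBP _ b'Y).
  have sub c : c \in Y :\: Bs -> l <= m c < u -> nbr c \subset Al :|: ((Y :\: Bs) :\: Y0) :|: Bs.
    move=> cY' /andP[lc cu]; have [cA' _ _ _] := YBP _ cY'.
    apply/subsetP => y cy; rewrite !in_setU.
    case yA: (y \in A).
      by rewrite (subsetP (nbrA_high c l cA' lc)) // inE cy.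
    case yB: (y \in Bs); rewrite ?orbT // orbF orbC.
    have yY : y \in Y :\: Bs by rewrite in_setD yB inE yA.
    rewrite in_setD yY andbT [y \in Y0]inE yY /= -leqNgt leqNgt; apply/orP; left.
    apply/negP => yl; move: cy; rewrite in_nbr adjC; apply/negP.
    exact: low_high.
  have := card_nbrU bb' (sub _ bY _) (sub _ b'Y _); rewrite lb lb' => /(_ bu b'u).
  have [a aA] : exists2 a, a \in A & def a < l.
    apply/exists_inP; apply: contraTT cost => /exists_inPn nlow.
    have : #|A| <= al l.
      by apply/subset_leq_card/subsetP => a aA; rewrite inE aA leqNgt nlow.
    by rewrite cA /x -leqNgt; move: Kgt0 xgt0; clear; lia.
  move=> al_; have : #|nbr a| <= #|Y0| + #|Bs|.
    apply: leq_trans (_ : #|Y0 :|: Bs| <= _); last by have [] := leq_card_setU Y0 Bs.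
    apply/subset_leq_card/subsetP => y ay; rewrite in_setU.
    have yA : y \notin A.
      by apply/negP => yA; have /indepP/(_ a y aA yA) := iA; rewrite -in_nbr ay.
    case yB: (y \in Bs); rewrite ?orbT // orbF inE in_setD yB inE yA /=.
    by apply: leq_ltn_trans (m_le yA aA _) al_; rewrite -in_nbr.
  have := nbrE a.
  have [+ _] := leq_card_setU (Al :|: ((Y :\: Bs) :\: Y0)) Bs.
  have [+ _] := leq_card_setU Al ((Y :\: Bs) :\: Y0); rewrite -/(al l).
  move: cost al_ Kgt0 xgt0 cY cYB luK l0 lu db db'; rewrite /x /K -/Bs.
  move: #|Al :|: (Y :\: Bs) :\: Y0| #|Al :|: (Y :\: Bs) :\: Y0 :|: Bs| => c1 c2.
  move: (def a) (def b) (def b') (al l) (al u) #|Bs| #|Y| #|Y0| #|nbr a| #|_| #|_|; clear; lia.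
have Y0_Yh : indep (Y0 :|: Yh).
  apply: indepU => //; last first.
    by move=> b b' /setIdP[bY bl] /setIdP[b'Y /andP[_ b'u]]; apply: low_high.
  apply/indepP => b b' /setIdP[bY bl] /setIdP[b'Y b'l].
  by apply: low_high => //; apply: leq_trans lu.
(* Replacing [Au] by [Y1] in [A] leaves an independent set. *)
have cY1 : #|Y1| <= #|Au|.
  have : indep ((A :\: Au) :|: Y1).
    apply: indepU => //; first by apply: indepS iA; apply: subsetDl.
    move=> a b /setDP[aA aAu] /setIdP[/YBP[bA _ _ _] ub].
    apply: contra aAu => ab; apply: (subsetP (nbrA_high b u bA ub)).
    by rewrite inE in_nbr adjC ab.
  move/le_s; rewrite cardsU (_ : _ :&: _ = set0); last first.
    apply/setP => a; rewrite [RHS]inE; apply/negP => /setIP[/setDP[aA _]].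
    by move=> /setIdP[/YBP[]]; rewrite aA.
  have := subset_leq_card (_ : Au \subset A); rewrite cards0 cardsDS.
    by rewrite cA => /(_ _) H; have := H; lia.
  by apply/subsetP => a; rewrite inE => /andP[].
have cY0h := le_s Y0_Yh.
(* Hence n - s <= s + [al u] + [#|Bs|], and n - 2 s >= 2 x because 3 n <= 8 s. *)
have sY : #|Y| <= #|Y0 :|: Yh| + #|Y1| + #|Bs|.
  have [le2 _] := leq_card_setU (Y0 :|: Yh :|: Y1) Bs.
  have [le1 _] := leq_card_setU (Y0 :|: Yh) Y1.
  apply: leq_trans (leq_trans le2 _); last by rewrite leq_add2r.
  apply/subset_leq_card/subsetP => y yY; rewrite !in_setU.
  case yB: (y \in Bs); rewrite ?orbT // orbF.
  have yYB : y \in Y :\: Bs by rewrite in_setD yB.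
  rewrite [y \in Y0]inE [y \in Yh]inE [y \in Y1]inE yYB /=.
  by rewrite -orbA [u <= _]leqNgt; case: (ltnP (m y) l) => //= _; case: ltnP.
move: cost cY1 cY0h sY cY Kgt0 xgt0 al_lu; rewrite -/(al u) /x -/Bs.
move: #|Bs| #|Y0 :|: Yh| #|Y1| #|Y|; clear; lia.
Qed.

Let cost_sym i : i < K -> 2 * x <= al i.+1 + al (K - i) + #|B i.+1 (K - i)|.
Proof.
move=> iK; have [le|lt] := leqP i.+1 (K - i).
  by apply: cost_ge; rewrite ?le //; lia.
have -> : B i.+1 (K - i) = B (K - i) i.+1.
  by apply/setP => b; rewrite !inE; congr (_ && (_ || _)); rewrite orbC.
by rewrite [al _ + _]addnC; apply: cost_ge; lia.
Qed.

(** The inequality [cost_sym] is summed over all K thresholds. A vertex [a] of [A] is counted at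
    most [def a] times by each [al]. A vertex [b] outside [A] is counted at most [2 * def b] times:
    K times if [K <= 2 * def b], otherwise once for each threshold in its two windows of length
    [def b]. *)
Lemma deficiency_bound_min : x * K <= \sum_v def v.
Proof.
have sum_al (f : nat -> nat) : (forall d, \sum_(i < K) (f i <= d) <= d) ->
    \sum_(i < K) al (f i) <= \sum_(a in A) def a.
  move=> fd; rewrite (eq_bigr (fun i : 'I_K => \sum_(a in A) (f i <= def a))) => [|i _].
    by rewrite exchange_big; apply: leq_sum => a _; apply: fd.
  rewrite /al -sum1_card big_mkcond [RHS]big_mkcond; apply: eq_bigr => a _.
  by rewrite inE; case: (a \in A); case: leq.
have sum1 : \sum_(i < K) al i.+1 <= \sum_(a in A) def a.
  apply: sum_al => d; apply: leq_trans (count_window K 0 d).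
  by apply: leq_sum => i _; rewrite add0n.
have sum2 : \sum_(i < K) al (K - i) <= \sum_(a in A) def a.
  apply: (sum_al (fun i => K - i)) => d; apply: leq_trans (count_window_rev K 0 d).
  by apply: leq_sum => i _; rewrite add0n subn_gt0 ltn_ord.
have sumB : \sum_(i < K) #|B i.+1 (K - i)| <= \sum_(b in ~: A) 2 * def b.
  rewrite (eq_bigr (fun i : 'I_K => \sum_(b in ~: A) (b \in B i.+1 (K - i)))) => [|i _].
    rewrite exchange_big; apply: leq_sum => b bA; rewrite inE in bA.
    have [Kd|dK] := leqP K (2 * def b).
      by apply: leq_trans Kd; rewrite -[leqRHS]mul1n -[in leqRHS](card_ord K) mulnC
        -sum_nat_const; apply: leq_sum => i _; case: (_ \in _).
    rewrite mul2n -addnn; apply: leq_trans (leq_add (count_window K (m b) (def b))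
      (count_window_rev K (m b) (def b))); rewrite -big_split; apply: leq_sum => i _ /=.
    rewrite inE inE bA [K <= _]leqNgt dK /= /th.
    by case: (m b < i.+1 <= _); case: (m b < _ <= _).
  rewrite -sum1_card big_mkcond [RHS]big_mkcond; apply: eq_bigr => b _.
  by rewrite /B !inE; case: (b \in A); case: (_ || _).
have : \sum_(i < K) 2 * x <= \sum_(i < K) (al i.+1 + al (K - i) + #|B i.+1 (K - i)|).
  by apply: leq_sum => i _; apply: cost_sym.
rewrite sum_nat_const card_ord !big_split /=.
have -> : \sum_v def v = \sum_(a in A) def a + \sum_(b in ~: A) def b.
  by rewrite (bigID (mem A)) /=; congr (_ + _); apply: eq_bigl => b; rewrite inE.
rewrite -big_distrr /= in sumB.
move: sum1 sum2 sumB; clear; move: (\sum_(_ < _) _) (\sum_(_ < _) _) (\sum_(_ < _) _).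
move=> u v w; lia.
Qed.

End Threshold.

Lemma deficiency_bound : (2 * n - 5 * s) * (8 * s - 3 * n) <= \sum_v (s - #|nbr v|).
Proof.
have [b|m mP] := @fin_all_exists T (fun _ => nat) (fun b k => b \notin A ->
    (forall a, a \in A -> adj a b -> k <= def a) /\
    exists a, [/\ a \in A, adj a b & k = def a]).
  (* Vertices of [A] get the dummy value 0. *)
  have [bA|bA] := boolP (b \in A); first by exists 0.
  have [a0 aA0 ab0] := nbrA bA.
  have P0 : (a0 \in A) && adj a0 b by rewrite aA0 ab0.
  case: (@arg_minnP T a0 (fun a => (a \in A) && adj a b) def P0) => a /andP[aA ab] amin.
  exists (def a) => _; split=> [c cinA cb|]; last by exists a.
  by apply: amin; rewrite cinA cb.
apply: (deficiency_bound_min (m := m)) => [b a /mP[+ _]|b /mP[_]] //.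
by apply.
Qed.

End Deficiency.

(** * The upper bound for all n and s *)

Section UpperBound.

Variables (T : finType) (E : {set {set T}}).
Local Notation adj := (adjacent E).
Local Notation indep := (independent E).
Local Notation nbr := (nbr E).
Local Notation n := #|T|.
Hypothesis tf : triangle_free E.

Lemma disjoint_nbr x y : adj x y -> [disjoint nbr x & nbr y].
Proof.
move=> xy; rewrite -setI_eq0; apply/eqP/setP => z; rewrite !inE.
apply/negP => /andP[xz yz].
by have /indepP/(_ y z) := indep_nbr x tf; rewrite !in_nbr yz => /(_ xy xz).
Qed.

Lemma disjoint_indep_nbr (A : {set T}) x : indep A -> x \in A -> [disjoint A & nbr x].
Proof.
move=> /indepP iA xA; rewrite -setI_eq0; apply/eqP/setP => z; rewrite !inE.
by apply/negP => /andP[zA]; apply/negP; apply: iA.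
Qed.

Lemma arcs_le s : (forall Z, indep Z -> #|Z| <= s) -> arcs E setT setT <= n * s.
Proof.
move=> le_s; rewrite -cardsT -sum_nat_const; apply: leq_sum => x _.
by rewrite setIT le_s // indep_nbr.
Qed.

Lemma arcs_bound_max (A : {set T}) s :
    indep A -> #|A| = s -> (forall Z, indep Z -> #|Z| <= s) ->
    3 * n < 8 * s -> 5 * s < 2 * n ->
  arcs E setT setT + 30 * (n * s) <= 6 * n ^ 2 + 40 * s ^ 2.
Proof.
move=> iA cA le_s d0 x0; pose def v := s - #|nbr v|.
pose low := fun q : (T * T) * (T * T) => let: ((a, b), (b', a')) := q in
  [&& a \in A, a' \in A, adj a b, adj b b', adj b' a' &
      def a + def b + def b' + def a' < 8 * s - 3 * n].
have cn v : #|nbr v| + def v = s by rewrite /def subnKC // le_s // indep_nbr.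
have [/existsP[[[a b] [b' a']] /and5P[aA a'A ab bb' /andP[b'a' lt]]]|/existsPn nlow] :=
    boolP [exists q, low q].
  pose F i := nth set0 [:: A; nbr a; nbr b; nbr b'; nbr a'] (i %% 5).
  apply: (@pentagon_bound _ _ s tf le_s F) => [i|i|i|].
  - by rewrite /F -(modnDr i 5); congr (nth _ _ (_ %% _)); lia.
  - by rewrite /F; case: (i %% 5) (ltn_pmod i (isT : 0 < 5)) => [|[|[|[|[|]]]]] //= _;
      apply: indep_nbr.
  - rewrite /F -(addn1 i) -modnDml.
    case: (i %% 5) (ltn_pmod i (isT : 0 < 5)) => [|[|[|[|[|]]]]] //= _;
      rewrite ?disjoint_nbr ?disjoint_indep_nbr //.
    by rewrite disjoint_sym disjoint_indep_nbr.
  rewrite !big_ord_recr big_ord0 /= /F /=.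
  move: lt; have := cn a; have := cn b; have := cn b'; have := cn a'.
  rewrite cA; move: (def a) (def b) (def b') (def a') #|nbr a| #|nbr b| #|nbr b'| #|nbr a'|.
  by move: d0 x0; move: #|T|; clear; lia.
have := @deficiency_bound T E s A tf le_s iA cA d0 x0.
have -> : arcs E setT setT = n * s - \sum_v def v.
  have : arcs E setT setT + \sum_v def v = n * s.
    rewrite /arcs big_mkcond -big_split -sum_nat_const; apply: eq_bigr => v _.
    by rewrite inE setIT /= cn.
  by move=> <-; rewrite addnK.
have le_def : \sum_v def v <= n * s.
  by rewrite -sum_nat_const; apply: leq_sum => v _; apply: leq_subr.
move=> H; have {}H : (2 * n - 5 * s) * (8 * s - 3 * n) <= \sum_v def v.
  apply: H => a b b' a' aA a'A _ _ ab bb' b'a'; rewrite leqNgt; apply/negP => lt.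
  by have := nlow (a, b, (b', a')); rewrite /low aA a'A ab bb' b'a' lt.
move: H le_def d0 x0; move: (\sum_v def v) #|T|; clear; rewrite -!mulnn.
(* With k for n, the claim is n s - x K <= 6 n^2 - 30 n s + 40 s^2, which is an equality: 6 n^2 - 31
   n s + 40 s^2 = (2 n - 5 s)(3 n - 8 s). *)
move=> D k; have [K eK] : exists K, K = 8 * s - 3 * k by exists (8 * s - 3 * k).
have [x ex] : exists x, x = 2 * k - 5 * s by exists (2 * k - 5 * s).
rewrite -eK -ex => H le_D d0 x0.
have -> : k = 8 * x + 5 * K by lia.
have -> : s = 3 * x + 2 * K by lia.
nia.
Qed.

(** For s outside the open interval from 3 n / 8 to 2 n / 5 the degree bound n s suffices, as (2 n -
    5 s)(3 n - 8 s) >= 0. Inside, the bound is applied to the true independence number: 6 n^2 - 30 n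
    s + 40 s^2 is increasing in s beyond 3 n / 8, where its minimum is 3 n^2 / 8. *)
Lemma arcs_bound s : (forall Z, indep Z -> #|Z| <= s) ->
  arcs E setT setT + 30 * (n * s) <= 6 * n ^ 2 + 40 * s ^ 2.
Proof.
move=> le_s; have := arcs_le le_s.
have [s8|s8] := leqP (8 * s) (3 * n); first by rewrite -!mulnn; nia.
have [s5|s5] := leqP (2 * n) (5 * s); first by rewrite -!mulnn; nia.
move=> _; have i0 : indep set0 by apply/indepP => u v; rewrite inE.
have [A iA maxA] := @arg_maxnP _ set0 indep (fun Z => #|Z|) i0.
have le_A := le_s A iA.
have [s08|s08] := leqP (8 * #|A|) (3 * n).
  have := arcs_le maxA; rewrite -!mulnn; nia.
have s05 : 5 * #|A| < 2 * n by lia.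
have := arcs_bound_max iA (erefl _) maxA s08 s05; rewrite -!mulnn.
move: le_A s8 s5 s08; clear; move: #|A| #|T| (arcs _ _ _) => s0 k z; nia.
Qed.

End UpperBound.

Lemma ex_num_upper n s : ex_num n s + 15 * (n * s) <= 3 * n ^ 2 + 20 * s ^ 2.
Proof.
(* Four times the difference is 3 (2 n - 5 s)^2 + 5 s^2, so the natural subtraction below is not
   truncated. *)
have pos : 15 * (n * s) <= 3 * n ^ 2 + 20 * s ^ 2.
  have : (0 <= (2 * n%:Z - 5 * s%:Z) * (2 * n%:Z - 5 * s%:Z))%R by rewrite -expr2 sqr_ge0.
  by have := leq0n (s * s); rewrite -!mulnn; lia.
suff : ex_num n s <= 3 * n ^ 2 + 20 * s ^ 2 - 15 * (n * s) by move: pos; clear; lia.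
apply/bigmax_leqP => E /and3P[sE tf le_s].
have le_Z Z : independent E Z -> #|Z| <= s.
  by move=> iZ; apply: leq_trans le_s; apply: leq_bigmax_cond.
have := arcs_bound tf le_Z; rewrite handshake // card_ord.
by move: pos; clear; lia.
Qed.

(** * The extremal graphs: weighted blow-ups of the Wagner graph *)

(** The disjoint union of the ordinals ['I_(sz i)] has n elements; the colour is the tag in an
    enumeration of it. *)
Lemma coloring_with_fibers k (sz : 'I_k -> nat) n : n = \sum_i sz i ->
  exists c : 'I_n -> 'I_k, forall i, #|[set v | c v == i]| = sz i.
Proof.
move=> nE; pose U := {i : 'I_k & 'I_(sz i)}.
have cU : n = #|{: U}|.
  by rewrite card_tagged nE sumnE big_map big_enum; apply: eq_bigr => i _; rewrite card_ord.
exists (fun v => tag (enum_val (cast_ord cU v) : U)) => i.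
have inj : injective (fun v => enum_val (cast_ord cU v) : U).
  by move=> u v /enum_val_inj /cast_ord_inj.
have injT : injective (Tagged (fun i => 'I_(sz i)) : 'I_(sz i) -> U).
  by move=> u v /eqP; rewrite eq_Tagged => /eqP.
rewrite -(card_imset _ inj) -[RHS]card_ord -(card_imset predT injT).
apply: eq_card => t; apply/imsetP/imsetP => [[v vi ->]|[u _ ->]].
  rewrite inE in vi; case: (enum_val _) vi => j u /= /eqP ij.
  by move: u; rewrite ij => u; exists u.
exists (cast_ord (esym cU) (enum_rank (Tagged (fun i => 'I_(sz i)) u : U))).
  by rewrite inE cast_ordKV enum_rankK.
by rewrite cast_ordKV enum_rankK.
Qed.

Lemma sum_fibers k n (c : 'I_n -> 'I_k) (sz F : 'I_k -> nat) :
  (forall i, #|[set v | c v == i]| = sz i) -> \sum_v F (c v) = \sum_i sz i * F i.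
Proof.
move=> csz; rewrite (partition_big c predT) //=; apply: eq_bigr => i _.
rewrite (eq_bigr (fun=> F i)) => [|v /eqP -> //].
by rewrite sum_nat_const -csz; congr (_ * _); apply: eq_card => v; rewrite inE.
Qed.

(* Adding 8 keeps the subtraction from being truncated, as [i < 8]. *)
Definition wagner (i j : nat) : bool := (j + 8 - i) %% 8 \in [:: 3; 4; 5].

(** Multiplication by 3 modulo 8 turns the differences 3, 4, 5 into 1, 4, 7, so [wagner] is an
    octagon with its long diagonals. *)
Definition blowup n (c : 'I_n -> 'I_8) : {set {set 'I_n}} :=
  [set e | [exists u, exists v, (e == [set u; v]) && wagner (c u) (c v)]].

(** Reduces a property of three colours to a computation over 512 cases. *)
Lemma forall_ord8 (P : nat -> nat -> nat -> bool) :
  all (fun i => all (fun j => all (P i j) (iota 0 8)) (iota 0 8)) (iota 0 8) ->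
  forall i j k : 'I_8, P i j k.
Proof.
move=> /allP H i j k.
have mem (l : 'I_8) : (l : nat) \in iota 0 8 by rewrite mem_iota /= ltn_ord.
by have /allP/(_ _ (mem j))/allP/(_ _ (mem k)) := H _ (mem i).
Qed.

Lemma adj_blowup n (c : 'I_n -> 'I_8) u v :
  adjacent (blowup c) u v = wagner (c u) (c v).
Proof.
have wC (i j : 'I_8) : wagner i j = wagner j i.
  by apply/eqP; apply: (@forall_ord8 (fun i j _ => wagner i j == wagner j i) _ i j i).
have w0 (i : 'I_8) : wagner i i = false.
  by apply/negP/negP; apply: (@forall_ord8 (fun i _ _ => ~~ wagner i i) _ i i i).
rewrite /adjacent inE; apply/existsP/idP => [[a /existsP[b /andP[/eqP eab wab]]]|w].
  have [ua va] : u \in [set a; b] /\ v \in [set a; b] by rewrite -eab !inE !eqxx orbT.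
  have [au bu] : a \in [set u; v] /\ b \in [set u; v] by rewrite eab !inE !eqxx orbT.
  move: ua va au bu; rewrite !inE => /orP[/eqP->|/eqP->] /orP[/eqP->|/eqP->] //.
  - by rewrite !orbb => _ /eqP ba; rewrite ba w0 in wab.
  - by rewrite wC.
  - by rewrite !orbb => /eqP ab; rewrite ab w0 in wab.
by exists u; apply/existsP; exists v; rewrite eqxx.
Qed.

(** The differences 3, 4, 5 form a sum-free set modulo 8. *)
Lemma blowup_triangle_free n (c : 'I_n -> 'I_8) : triangle_free (blowup c).
Proof.
apply/existsPn => u; apply/existsPn => v; apply/existsPn => t; rewrite !adj_blowup.
apply: (@forall_ord8 (fun i j k => ~~ [&& wagner i j, wagner j k & wagner i k])).
by [].
Qed.

Lemma blowup_simple n (c : 'I_n -> 'I_8) : simple_graph (blowup c).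
Proof.
apply/forall_inP => e; rewrite inE => /existsP[u /existsP[v /andP[/eqP -> w]]].
rewrite cards2; have [uv|//] := eqVneq u v; move: w; rewrite uv.
by rewrite (negPf (@forall_ord8 (fun i _ _ => ~~ wagner i i) isT (c v) (c v) (c v))).
Qed.

Definition wagner_sizes (x y : nat) (i : 'I_8) : nat :=
  nth 0 [:: y; y; x; y; y; x; y; x] i.

(* The sizes are arranged so that any three cyclically consecutive ones, which
   form the maximal independent sets of the Wagner graph, sum to at most [x + 2 y]. *)
Lemma blowup_independent n (c : 'I_n -> 'I_8) x y (A : {set 'I_n}) : x <= y ->
    (forall i, #|[set v | c v == i]| = wagner_sizes x y i) ->
  independent (blowup c) A -> #|A| <= x + 2 * y.
Proof.
move=> xy cF /indepP iA.
pose f (i : nat) := [exists v in A, c v == i :> nat].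
have leA : #|A| <= \sum_(i < 8) f i * wagner_sizes x y i.
  rewrite -sum1_card (partition_big c predT) //=; apply: leq_sum => i _.
  rewrite sum1_card /f; case: exists_inP => [_|nf].
    rewrite mul1n -cF; apply/subset_leq_card/subsetP => v.
    by case/andP=> _ vi; rewrite inE.
  rewrite mul0n leqn0; apply/eqP/eq_card0 => v; apply/negP => /andP[vA vi].
  by apply: nf; exists v.
have fP i j : wagner i j -> f i && f j = false.
  move=> w; apply/negP => /andP[/exists_inP[u uA /eqP ui] /exists_inP[v vA /eqP vj]].
  by move: (iA u v uA vA); rewrite adj_blowup ui vj w.
apply: leq_trans leA _; rewrite !big_ord_recr big_ord0 /= /wagner_sizes /=.
(* The disjuncts are the twelve edges of the Wagner graph; what remains is a check of all sets of
   occurring colours. *)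
have : ~~ [|| f 0 && f 3, f 0 && f 4, f 0 && f 5, f 1 && f 4, f 1 && f 5, f 1 && f 6,
  f 2 && f 5, f 2 && f 6, f 2 && f 7, f 3 && f 6, f 3 && f 7 | f 4 && f 7].
  by rewrite !fP.
move: xy; clear; move: (f 0) (f 1) (f 2) (f 3) (f 4) (f 5) (f 6) (f 7).
by do 8 (case); rewrite //= => xy _; lia.
Qed.

Lemma ex_num_lower n s : 3 * n <= 8 * s -> 5 * s <= 2 * n ->
  3 * n ^ 2 + 20 * s ^ 2 <= ex_num n s + 15 * (n * s).
Proof.
move=> s8 s5.
(* The sizes solve n = 3 x + 5 y and s = x + 2 y; the two hypotheses amount to [x <= y] and to x not
   being truncated. *)
have [x ex] : exists x, x = 2 * n - 5 * s by exists (2 * n - 5 * s).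
have [y ey] : exists y, y = 3 * s - n by exists (3 * s - n).
have nE : n = 3 * x + 5 * y by lia.
have sE : s = x + 2 * y by lia.
have xy : x <= y by lia.
have szE : n = \sum_i wagner_sizes x y i.
  by rewrite !big_ord_recr big_ord0 /= /wagner_sizes /= nE; lia.
have [c cF] := coloring_with_fibers szE.
have : #|blowup c| <= ex_num n s.
  apply: (@leq_bigmax_cond _ _ (fun E : {set {set 'I_n}} => #|E|)).
  rewrite blowup_simple blowup_triangle_free; apply/bigmax_leqP => A.
  by rewrite sE; apply: blowup_independent.
have := handshake (blowup_simple c).
have -> : arcs (blowup c) setT setT
    = \sum_i wagner_sizes x y i * \sum_j wagner_sizes x y j * wagner i j.
  rewrite -(sum_fibers _ cF) /arcs big_mkcond; apply: eq_bigr => u _ /=.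
  rewrite inE setIT -(sum_fibers (fun j => wagner (c u) j) cF) -sum1_card big_mkcond.
  by apply: eq_bigr => v _ /=; rewrite in_nbr adj_blowup; case: wagner.
rewrite !big_ord_recr !big_ord0 /= /wagner_sizes /wagner /=.
move: #|_| (ex_num _ _) => e m; rewrite nE sE -!mulnn; clear; lia.
Qed.

Local Open Scope ring_scope.

Theorem theorem3p5 (n s : nat) (le_s_n : (s <= n)%N) :
  (ex_num n s)%:Z <= 3 * n%:Z ^+ 2 - 15 * n%:Z * s%:Z + 20 * s%:Z ^+ 2
  /\ (3 / 8 * n%:R <= s%:R :> rat -> s%:R <= 2 / 5 * n%:R :> rat ->
      (ex_num n s)%:Z = 3 * n%:Z ^+ 2 - 15 * n%:Z * s%:Z + 20 * s%:Z ^+ 2).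
Proof.
have upper := ex_num_upper n s; rewrite -!mulnn in upper.
split; first by rewrite !expr2; lia.
move=> s8 s5; have {}s8 : (3 * n <= 8 * s)%N.
  by rewrite -(ler_nat rat) !natrM; lra.
have {}s5 : (5 * s <= 2 * n)%N by rewrite -(ler_nat rat) !natrM; lra.
by have := ex_num_lower s8 s5; rewrite -!mulnn !expr2; lia.
Qed.
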